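(* Let $\alpha_1,\alpha_2>0$ with $\alpha_1+\alpha_2=\alpha\in(0,1)$. Then the random set $$I^*_{\alpha_1,\alpha_2}(Y)=[\theta^*(1-\alpha_1,Y),\,\theta^*(\alpha_2,Y)]$$ is an exact $100(1-\alpha)\%$ confidence interval for $\theta$; that is, for every $\theta\in\Theta$, $$\mathsf P_{\theta}\{\theta^*(1-\alpha_1,Y)\leqslant\theta\leqslant\theta^*(\alpha_2,Y)\}=1-\alpha.$$
   Context: Setting. The parameter space $\Theta$ of the real parameter $\theta$ is an open, half-open or closed interval with endpoints $\underline{\theta}<\overline{\theta}$, which may be $-\infty$ and/or $\infty$, respectively. $Y$ is a real-valued statistic whose distribution under the probability measure $\mathsf P_\theta$, $\theta\in\Theta$, has cumulative distribution function $F(y;\theta)=\mathsf P_\theta(Y\leqslant y)$, which is continuous in both $y\in\mathbb R$ and $\theta\in\Theta$. $\mathcal Y$ denotes the support of $Y$. $Y$ is stochastically increasing in $\theta$, i.e. $F(y;\theta)$ is a decreasing function of $\theta$ for each $y$, and this monotonicity with respect to $\theta$ is assumed to be strict. Put $F(y;\underline{\theta})=\lim_{\theta\downarrow\underline{\theta}}F(y;\theta)$ and $F(y;\overline{\theta})=\lim_{\theta\uparrow\overline{\theta}}F(y;\theta)$ (these limits exist by monotonicity and boundedness). For $y\in\mathcal Y$ and $\alpha\in(0,1)$, the equation $F(y;\theta)=\alpha$ has a solution $\theta=\theta(\alpha,y)\in(\underline{\theta},\overline{\theta})$ if and only if $F(y;\overline{\theta})<\alpha<F(y;\underline{\theta})$.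 Define $$\theta^*(\alpha,y)=\begin{cases}\underline{\theta}, & \text{if } F(y;\underline{\theta})\leqslant\alpha,\\ \theta(\alpha,y), & \text{if } F(y;\overline{\theta})<\alpha<F(y;\underline{\theta}),\\ \overline{\theta}, & \text{if } F(y;\overline{\theta})\geqslant\alpha.\end{cases}$$
   Formalization: The coverage identity is proved for every θ in Θ other than the endpoints of Θ; at an endpoint belonging to Θ the printed claim is false (the coverage is 1−α1 at the lower and 1−α2 at the upper endpoint). *)

(* Defs.v *)
From HB Require Import structures.
From mathcomp Require Export all_boot all_order all_algebra.
From mathcomp Require Export all_classical all_reals all_analysis.
Export Order.TTheory GRing.Theory Num.Theory.
Export numFieldNormedType.Exports.

Set Implicit Arguments.
Unset Strict Implicit.
Unset Printing Implicit Defensive.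

Local Open Scope classical_set_scope.
Local Open Scope ring_scope.

(* [P] is indexed by all of [R]; only its values on the parameter space are
   ever constrained. *)
Definition cdf_family d (T : measurableType d) (R : realType)
    (P : R -> probability T R) (Y : {mfun T >-> R}) (y theta : R) : R :=
  fine (cdf (Y : {RV (P theta) >-> R}) y).

(* One-sided limit of [f] at the left (resp. right) end of an interval with
   nonempty interior: that end is never +oo (resp. -oo), and the value 0 given
   there is a dummy. *)
Definition lim_lower_end (R : realType) (lo : \bar R) (f : R -> R) : R :=
  match lo with
  | EFin a => lim (f t @[t --> a^'+])
  | -oo%E => lim (f t @[t --> -oo])
  | +oo%E => 0
  end.

Definition lim_upper_end (R : realType) (hi : \bar R) (f : R -> R) : R :=
  match hi with
  | EFin b => lim (f t @[t --> b^'-])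
  | +oo%E => lim (f t @[t --> +oo])
  | -oo%E => 0
  end.

(* For [F y] strictly decreasing on ]lo, hi[ the first two tests exclude each
   other and, when both fail, the solution picked by [xget] is unique. *)
Definition theta_star (R : realType) (F : R -> R -> R) (lo hi : \bar R)
    (alpha y : R) : \bar R :=
  if lim_lower_end lo (F y) <= alpha then lo
  else if alpha <= lim_upper_end hi (F y) then hi
  else (xget 0 [set t : R | (lo < t%:E < hi)%E /\ F y t = alpha])%:E.

(* Main.v *)
Require Import Defs.
From mathcomp Require Import all_boot all_order all_algebra.
From mathcomp Require Import all_classical all_reals all_analysis.
From mathcomp Require Import measurable_realfun lra.

(* At an interior [theta], and for [y] in the support, the monotonicity of
   [F y] turns [theta_star a y <= theta] into [F y theta <= a], and
   symmetrically, whether or not [F y t = a] has a solution. The covering event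
   is thus [alpha2 <= F Y theta <= 1 - alpha1], and [F Y theta] is uniformly
   distributed on the unit interval under [P theta]. *)

Local Open Scope classical_set_scope.
Local Open Scope ring_scope.

(** An abstract filter that eventually lies in [A] below each of its points covers both a finite
    left end and [-oo]. A point of [A] nearly attaining the supremum bounds [f] from below on all
    smaller points of [A]. *)
Lemma cvg_nonincreasing_sup (R : realType) (f : R -> R) (A : set R)
    (F : set_system R) (FF : ProperFilter F) :
  (forall s t, A s -> A t -> s <= t -> f t <= f s) ->
  has_sup (f @` A) -> (forall s, A s -> \forall t \near F, A t /\ t <= s) ->
  f t @[t --> F] --> sup (f @` A).
Proof.
move=> f_decr supA nearF; apply/cvgrPdist_le => e e0.
have [_ [s As <-] es] := sup_adherent e0 supA.
apply: filterS (nearF _ As) => t [At ts].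
rewrite ler_norml lerBlDr lerBrDl.
have := f_decr _ _ At As ts.
have : f t <= sup (f @` A) by apply: ub_le_sup; [exact: supA.2|exists t].
by lra.
Qed.

Lemma cvg_nonincreasing_inf (R : realType) (f : R -> R) (A : set R)
    (F : set_system R) (FF : ProperFilter F) :
  (forall s t, A s -> A t -> s <= t -> f t <= f s) ->
  has_inf (f @` A) -> (forall s, A s -> \forall t \near F, A t /\ s <= t) ->
  f t @[t --> F] --> inf (f @` A).
Proof.
move=> f_decr infA nearF; apply/cvgrPdist_le => e e0.
have [_ [s As <-] es] := inf_adherent e0 infA.
apply: filterS (nearF _ As) => t [At ts].
rewrite ler_norml.
have := f_decr _ _ As At ts.
have : inf (f @` A) <= f t by apply: ge_inf; [exact: infA.2|exists t].
by lra.
Qed.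

(** Turns the first test in [theta_star] into a comparison with a supremum, from which points of [A]
    can be extracted. *)
Lemma lim_lower_endE (R : realType) (lo hi : \bar R) (f : R -> R) :
  let A := [set t : R | (lo < t%:E < hi)%E] in
  (forall s t, A s -> A t -> s <= t -> f t <= f s) -> has_sup (f @` A) ->
  lim_lower_end lo f = sup (f @` A).
Proof.
move=> A f_decr supA; case: (supA) => -[_ [s /andP[los shi] _]] _.
(* The point [s] of [A] rules out [lo = +oo], where [lim_lower_end] has its dummy value. *)
case: lo @A f_decr supA los => [a| |]// A f_decr supA los;
  apply/cvg_lim => //; apply: cvg_nonincreasing_sup => // t /andP[at_ thi].
- near=> u; have ut : u <= t.
    by near: u; apply: nbhs_right_ltW; rewrite -lte_fin.
  split=> //; rewrite /A/= (le_lt_trans _ thi) ?lee_fin// andbT lte_fin.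
  by near: u; exact: nbhs_right_gt.
- near=> u; have ut : u <= t by near: u; exact: nbhs_ninfty_le.
  by split=> //; rewrite /A/= ltNyr (le_lt_trans _ thi) ?lee_fin.
Unshelve. all: by end_near. Qed.

Lemma lim_upper_endE (R : realType) (lo hi : \bar R) (f : R -> R) :
  let A := [set t : R | (lo < t%:E < hi)%E] in
  (forall s t, A s -> A t -> s <= t -> f t <= f s) -> has_inf (f @` A) ->
  lim_upper_end hi f = inf (f @` A).
Proof.
move=> A f_decr infA; case: (infA) => -[_ [s /andP[los shi] _]] _.
case: hi @A f_decr infA shi => [b| |]// A f_decr infA shi;
  apply/cvg_lim => //; apply: cvg_nonincreasing_inf => // t /andP[lot tb].
- near=> u; have tu : t < u.
    by near: u; apply: nbhs_left_gt; rewrite -lte_fin.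
  have ub : u < b by near: u; exact: nbhs_left_lt.
  by split; [rewrite /A/= (lt_trans lot) ?lte_fin | exact: ltW].
- near=> u; have tu : t <= u by near: u; exact: nbhs_pinfty_ge.
  by split=> //; rewrite /A/= ltry (lt_le_trans lot) ?lee_fin.
Unshelve. all: by end_near. Qed.

(** Each end value of [theta_star] decides both comparisons, because [F y theta] lies strictly
    between the infimum and the supremum. Otherwise the intermediate value theorem gives a root, and
    strict monotonicity transfers the order. *)
Lemma theta_star_cmp (R : realType) (F : R -> R -> R) (lo hi : \bar R)
    (y alpha theta : R) :
  let A := [set t : R | (lo < t%:E < hi)%E] in
  has_ubound (F y @` A) -> has_lbound (F y @` A) ->
  (forall s t, A s -> A t -> s < t -> F y t < F y s) ->
  {within A, continuous (F y)} -> A theta ->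
  ((theta_star F lo hi alpha y <= theta%:E)%E = (F y theta <= alpha)) *
  ((theta%:E <= theta_star F lo hi alpha y)%E = (alpha <= F y theta)).
Proof.
move=> A ubA lbA F_decr F_cont Atheta.
have A_itv s t u : A s -> A t -> s <= u -> u <= t -> A u.
  move=> /andP[los _] /andP[_ thi] su ut; apply/andP; split.
    by rewrite (lt_le_trans los)// lee_fin.
  by rewrite (le_lt_trans _ thi)// lee_fin.
have F_decrW s t : A s -> A t -> s <= t -> F y t <= F y s.
  move=> As At; rewrite le_eqVlt => /predU1P[->//|st].
  exact/ltW/F_decr.
have neA : F y @` A !=set0 by exists (F y theta), theta.
have /andP[lo_th th_hi] := Atheta.
(* Points of [A] on either side of [theta] make the bounds [ltsup] and [inflt] strict. They are
   midpoints towards a finite end and unit shifts towards an infinite one. *)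
have [s As s_th] : exists2 s, A s & s < theta.
  case: lo @A {ubA lbA F_decr F_cont A_itv F_decrW neA} Atheta lo_th
      => [a| |]// A Atheta lo_th.
  - exists ((a + theta) / 2); last by rewrite midf_lt.
    rewrite /A/= lte_fin midf_lt//= (lt_trans _ th_hi)// lte_fin.
    by rewrite midf_lt.
  - exists (theta - 1); last by rewrite gtrBl.
    by rewrite /A/= ltNyr (lt_trans _ th_hi)// lte_fin gtrBl.
have [t At th_t] : exists2 t, A t & theta < t.
  case: hi @A {ubA lbA F_decr F_cont A_itv F_decrW neA As} Atheta th_hi
      => [b| |]// A Atheta th_hi.
  - exists ((theta + b) / 2); last by rewrite midf_lt.
    rewrite /A/= lte_fin midf_lt//= andbT (lt_trans lo_th)// lte_fin.
    by rewrite midf_lt.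
  - exists (theta + 1); last by rewrite ltrDl.
    by rewrite /A/= ltry (lt_trans lo_th)// lte_fin ltrDl.
rewrite /theta_star (lim_lower_endE _ lo hi)// (lim_upper_endE _ lo hi)//.
have ltsup : F y theta < sup (F y @` A).
  by apply: (lt_le_trans (F_decr _ _ As Atheta s_th));
    apply: ub_le_sup => //; exists s.
have inflt : inf (F y @` A) < F y theta.
  by apply: (le_lt_trans _ (F_decr _ _ Atheta At th_t));
    apply: ge_inf => //; exists t.
case: ifPn => [supa|].
  have Fa := lt_le_trans ltsup supa.
  by rewrite (ltW lo_th) (ltW Fa) leNgt lo_th leNgt Fa.
rewrite -ltNge => alt; case: ifPn => [ainf|].
  have Fa := le_lt_trans ainf inflt.
  by rewrite (ltW th_hi) (ltW Fa) leNgt th_hi leNgt Fa.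
rewrite -ltNge => lta.
(* Here [alpha] is strictly between the infimum and the supremum, so values of [F y] at two points
   of [A] bracket it. *)
have [_ [p Ap <-] ap] := sup_gt neA alt.
have [_ [q Aq <-] qa] := inf_lt neA lta.
have pq : p <= q.
  by rewrite leNgt; apply/negP => /(F_decr _ _ Aq Ap);
    rewrite ltNge (ltW (lt_trans qa ap)).
have [c] : exists2 c, c \in `[p, q] & F y c = alpha.
  apply: IVT => //.
    apply: continuous_subspaceW F_cont => u /=; rewrite in_itv/= => /andP[].
    exact: A_itv.
  rewrite (min_idPr _) ?(max_idPl _) ?F_decrW//.
  by rewrite (ltW ap) (ltW qa).
rewrite in_itv/= => /andP[pc cq] Fc.
have Ac : A c by exact: A_itv pc cq.
(* The root [c] only excludes the default value 0 of [xget]; the comparison uses the chosen root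
   [c']. *)
case: xgetP => [c' _ [Ac' Fc']|/(_ c)[]//].
rewrite !lee_fin -Fc'; split.
- have [c'th|thc'] := lerP c' theta; first by rewrite F_decrW.
  by apply/esym/negbTE; rewrite -ltNge F_decr.
- have [c'th|thc'] := lerP theta c'; first by rewrite F_decrW.
  by apply/esym/negbTE; rewrite -ltNge F_decr.
Qed.

(** The limits 0 and 1 at the two infinities bracket [u], and continuity fills the gap. The point
    [q] is a quantile of level [u]. *)
Lemma cdf_surj d (T : measurableType d) (R : realType) (P : probability T R)
    (X : {RV P >-> R}) (u : R) :
  continuous (fine \o cdf X) -> 0 < u < 1 -> exists q, cdf X q = u%:E.
Proof.
move=> H_cont /andP[u0 u1].
have cdf_fin x : cdf X x \is a fin_num by exact: fin_num_measure.
have H_homo x y : x <= y -> fine (cdf X x) <= fine (cdf X y).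
  by move=> xy; rewrite fine_le ?cdf_fin//; exact: cdf_nondecreasing.
have [a Ha] : exists a, fine (cdf X a) < u.
  exact: filter_ex (cvgr_lt _ (fine_cvg (cvg_cdfNy0 X)) _ u0).
have [b Hb] : exists b, u < fine (cdf X b).
  exact: filter_ex (cvgr_gt _ (fine_cvg (cvg_cdfy1 X)) _ u1).
have ab : a <= b.
  by rewrite leNgt; apply/negP => /ltW/H_homo; rewrite leNgt (lt_trans Ha Hb).
have [] := @IVT _ (fine \o cdf X) a b u ab.
- exact: continuous_subspaceT.
- by rewrite (min_idPl _) ?(max_idPr _) ?H_homo//= (ltW Ha) (ltW Hb).
by move=> q _ Hq; exists q; rewrite -Hq /= fineK.
Qed.

(* Comparison with the event [X <= q], where [H q = v], gives
   [P (H X < v) <= v <= P (H X <= v)] at every level [v]; comparing two nearby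
   levels closes the gap. *)
Lemma probability_integral_transform d (T : measurableType d) (R : realType)
    (P : probability T R) (X : {RV P >-> R}) (u : R) :
  let H := fine \o cdf X in
  continuous H -> 0 < u < 1 ->
  P [set w | H (X w) <= u] = u%:E /\ P [set w | H (X w) < u] = u%:E.
Proof.
move=> H H_cont u01; have /andP[u0 u1] := u01.
have H_homo x y : x <= y -> H x <= H y.
  by move=> xy; rewrite fine_le ?fin_num_measure//; exact: cdf_nondecreasing.
have mH : measurable_fun setT (H \o X).
  by apply: measurableT_comp => //; exact: continuous_measurable_fun.
have mle v : measurable [set w | H (X w) <= v].
  by rewrite -preimage_itvNyc -[X in measurable X]setTI; exact: mH.
have mlt v : measurable [set w | H (X w) < v].
  by rewrite -preimage_itvNyo -[X in measurable X]setTI; exact: mH.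
have mX q : measurable (X @^-1` `]-oo, q]) by exact: measurable_funPTI.
(* With [H q = v], a value [X w] above [q] would give [v <= H (X w)] by monotonicity. *)
have le_q (v : R) : 0 < v < 1 -> (P [set w | (H (X w) < v)%R] <= v%:E)%E.
  move=> /(cdf_surj _ _ _ _ _ _ H_cont)[q Hq].
  rewrite -[leRHS]Hq; apply: le_measure; rewrite ?inE//.
  move=> w /=; rewrite in_itv/= leNgt => wq; apply/negP => qw.
  by move: wq; rewrite ltNge -[v]/(fine v%:E) -Hq H_homo// ltW.
have ge_q (v : R) : 0 < v < 1 -> (v%:E <= P [set w | (H (X w) <= v)%R])%E.
  move=> /(cdf_surj _ _ _ _ _ _ H_cont)[q Hq].
  rewrite -[leLHS]Hq; apply: (le_measure P); rewrite ?inE//.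
  by move=> w /=; rewrite in_itv/= -[v]/(fine v%:E) -Hq; exact: H_homo.
split; apply/eqP; rewrite eq_le.
(* If the probability exceeded [u], [le_q] would fail at the midpoint [v] of the two, which is below
   1 because it is below a probability. *)
- rewrite ge_q// andbT leNgt; apply/negP.
  rewrite -[ltRHS]fineK ?fin_num_measure// lte_fin => /[dup] uP /midf_lt[].
  set v := (u + _) / 2 => uv.
  rewrite -lte_fin fineK ?fin_num_measure// => vP.
  have v1 : v < 1 by rewrite -lte_fin (lt_le_trans vP)// probability_le1.
  have := le_q v; rewrite (lt_trans u0 uv) v1 => /(_ isT).
  apply/negP; rewrite -ltNge; apply: (lt_le_trans vP).
  by apply: le_measure; rewrite ?inE// => w /= /le_lt_trans; exact.
(* Symmetrically, [ge_q] would fail at the midpoint, which is positive because it is above a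
   probability. *)
- rewrite le_q//= leNgt; apply/negP.
  rewrite -[ltLHS]fineK ?fin_num_measure// lte_fin => /[dup] uP /midf_lt[].
  set v := (_ + u) / 2 => + vu.
  rewrite -lte_fin fineK ?fin_num_measure// => Pv.
  have v0 : 0 < v by rewrite -lte_fin (le_lt_trans _ Pv).
  have := ge_q v; rewrite (lt_trans vu u1) v0 => /(_ isT).
  apply/negP; rewrite -ltNge; apply: (le_lt_trans _ Pv).
  by apply: le_measure; rewrite ?inE// => w /= /le_lt_trans; exact.
Qed.

(** An endpoint belonging to [Theta] is excluded: at [lo] the upper bound on [theta] always holds,
    so the coverage is [1 - alpha1], and at [hi] it is likewise [1 - alpha2]. Strict monotonicity is
    confined to [supp], since elsewhere the cdf may be 0 or 1 for every parameter. *)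
Theorem theorem1 (R : realType) (d : measure_display) (T : measurableType d)
    (lo hi : \bar R) (Theta : set R)
    (P : R -> probability T R) (Y : {mfun T >-> R}) (supp : set R)
    (lo_lt_hi : (lo < hi)%E)
    (Theta_sup : forall t : R, (lo < t%:E < hi)%E -> Theta t)
    (Theta_sub : forall t : R, Theta t -> (lo <= t%:E <= hi)%E)
    (supp_meas : measurable supp)
    (supp_carries : forall t : R, Theta t -> P t (Y @^-1` supp) = 1%E)
    (F_cont_y : forall t : R, Theta t ->
      continuous (fun y : R => cdf_family P Y y t))
    (F_cont_theta : forall y : R,
      {within Theta, continuous (fun t : R => cdf_family P Y y t)})
    (F_decr : forall y s t : R, Theta s -> Theta t -> s <= t ->
      cdf_family P Y y t <= cdf_family P Y y s)
    (F_decr_strict : forall y s t : R, supp y -> Theta s -> Theta t -> s < t ->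
      cdf_family P Y y t < cdf_family P Y y s)
    (alpha1 alpha2 alpha : R)
    (alpha1_gt0 : 0 < alpha1) (alpha2_gt0 : 0 < alpha2)
    (alpha_sum : alpha1 + alpha2 = alpha) (alpha_01 : 0 < alpha < 1)
    (theta : R) (theta_in : Theta theta)
    (theta_neq_lo : theta%:E <> lo) (theta_neq_hi : theta%:E <> hi) :
  let covered := [set w : T | supp (Y w) /\
    (theta_star (cdf_family P Y) lo hi (1 - alpha1) (Y w) <= theta%:E
      <= theta_star (cdf_family P Y) lo hi alpha2 (Y w))%E] in
  measurable covered /\ P theta covered = (1 - alpha)%:E.
Proof.
move=> covered.
set H := fun y => cdf_family P Y y theta.
have H_cont : continuous H by exact: F_cont_y.
have theta_int : (lo < theta%:E < hi)%E.
  have /andP[lo_th th_hi] := Theta_sub _ theta_in.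
  rewrite !lt_neqAle lo_th th_hi !andbT.
  by apply/andP; split; apply/eqP => // /esym.
have F01 y t : 0 <= cdf_family P Y y t <= 1.
  rewrite -!lee_fin fineK ?fin_num_measure// cdf_ge0/=.
  exact: (cdf_le1 (Y : {RV (P t) >-> R})).
pose S := Y @^-1` supp.
pose A := [set w | alpha2 <= H (Y w) <= 1 - alpha1].
(* The restriction to [S] supplies the strict monotonicity that [theta_star_cmp] requires. *)
have coveredE : covered = A `&` S.
  rewrite setIC; apply/seteqP.
  suff cmp w : supp (Y w) -> forall a,
      let star := theta_star (cdf_family P Y) lo hi a (Y w) in
      ((star <= theta%:E)%E = (H (Y w) <= a)) *
      ((theta%:E <= star)%E = (a <= H (Y w))).
    by split=> w [Sw]; rewrite /covered /A/= ?cmp// andbC.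
  move=> Sw a; apply: theta_star_cmp => //.
  - by exists 1 => _ [t _ <-]; case/andP: (F01 (Y w) t).
  - by exists 0 => _ [t _ <-]; case/andP: (F01 (Y w) t).
  - by move=> s t /Theta_sup As /Theta_sup At; exact: F_decr_strict.
  - exact: continuous_subspaceW (F_cont_theta (Y w)).
have mH : measurable_fun setT (H \o Y).
  by apply: measurableT_comp => //; exact: continuous_measurable_fun.
have mle v : measurable [set w | H (Y w) <= v].
  by rewrite -preimage_itvNyc -[X in measurable X]setTI; exact: mH.
have mlt v : measurable [set w | H (Y w) < v].
  by rewrite -preimage_itvNyo -[X in measurable X]setTI; exact: mH.
(* The difference involves just the two kinds of events whose probabilities the integral transform
   gives. *)
have AE : A = [set w | H (Y w) <= 1 - alpha1] `\` [set w | H (Y w) < alpha2].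
  apply/seteqP; split=> w; rewrite /A/=.
    by move=> /andP[aH ->]; split=> //; apply/negP; rewrite -leNgt.
  by move=> [-> /negP]; rewrite -leNgt => ->.
have mA : measurable A by rewrite AE; exact: measurableD.
have mS : measurable S by exact: measurable_funPTI.
have /andP[alpha_gt0 alpha_lt1] := alpha_01.
have PA : P theta A = (1 - alpha)%:E.
  have pit u := probability_integral_transform _ _ _ _
    (Y : {RV (P theta) >-> R}) u H_cont.
  have Ple : P theta [set w | H (Y w) <= 1 - alpha1] = (1 - alpha1)%:E.
    by apply: (pit _ _).1; lra.
  have Plt : P theta [set w | H (Y w) < alpha2] = alpha2%:E.
    by apply: (pit _ _).2; lra.
  rewrite AE measureD//; last by rewrite [ltLHS]Ple ltry.
  (* The events are nested since [alpha < 1] gives [alpha2 <= 1 - alpha1]. *)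
  rewrite setIidr; last by move=> w /= /ltW /le_trans; apply; lra.
  by rewrite [X in (X - _)%E]Ple [X in (_ - X)%E]Plt -EFinB; congr EFin; lra.
rewrite coveredE; split; first exact: measurableI.
(* As [S] has a null complement, intersecting with it leaves the probability of [A] unchanged. *)
have PSC : P theta (~` S) = 0%E.
  by rewrite probability_setC// supp_carries// subee.
rewrite -PA (measureDI (P theta) mA mS).
rewrite [X in (X + _)%E](subset_measure0 _ _ _ PSC) ?add0e//.
- exact: measurableD.
- exact: measurableC.
Qed.
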